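(* Let $n\ge 1$. The reverse permutation $n,n-1,\dots,1$ is the only permutation in $S_n$ requiring $n-1$ steps, i.e. the only $\pi\in S_n$ for which the minimum number of placements needed to reach the identity from $\pi$ is $n-1$.
   Context: A permutation $\pi\in S_n$ is written as the sequence $\pi(1),\dots,\pi(n)$, where $\pi(i)$ is the number in the $i$th position and $\pi^{-1}(i)$ is the position of the number $i$. A number $i$ is at home if $\pi(i)=i$. If $i$ is not at home, it may be placed: $i$ is removed from its current position $\pi^{-1}(i)$ and reinserted at position $i$, the numbers in the intervening positions each shifting by one position toward the vacated position, and all other numbers staying where they are. Each placement is one step. A permutation requires $m$ steps if $m$ is the minimum length of a sequence of placements leading from it to the identity. *)

(* Defs.v *)
From mathcomp Require Import all_boot all_order all_fingroup.
From mathcomp Require Import zify.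

Set Implicit Arguments.
Unset Strict Implicit.
Unset Printing Implicit Defensive.

Local Open Scope group_scope.

(* Numbers and positions are both elements of 'I_n, i.e. they are 0, ..., n-1
   instead of 1, ..., n; s k is the number in position k and s^-1 i is the
   position of the number i. *)

(* New position of the number currently in position q, when the number in
   position p is removed and reinserted at position i. *)
Definition moved_pos (p i q : nat) : nat :=
  if q == p then i
  else if p < q <= i then q.-1
  else if i <= q < p then q.+1
  else q.

Lemma moved_pos_ltn n (p i q : 'I_n) : moved_pos p i q < n.
Proof.
rewrite /moved_pos; move: p i q => [p ltp] [i lti] [q ltq] /=.
by repeat case: ifP => /= ?; lia.
Qed.

Definition moved_ord n (p i q : 'I_n) : 'I_n := Ordinal (moved_pos_ltn p i q).

Lemma moved_ord_inj n (p i : 'I_n) : injective (moved_ord p i).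
Proof.
move=> q r /(congr1 val) /=; rewrite /moved_pos => eq_qr; apply: val_inj.
move: eq_qr => /=; case: p i q r => [p ?] [i ?] [q ?] [r ?] /=.
by repeat case: ifP => /= ?; lia.
Qed.

(* A number j is sent to its new position by s^-1 followed by moved_ord;
   permutations compose left to right: (s * t) x = t (s x). *)
Definition place n (i : 'I_n) (s : 'S_n) : 'S_n :=
  (s^-1 * perm (@moved_ord_inj n (s^-1 i) i))^-1.

Lemma place_posE n (i : 'I_n) (s : 'S_n) (j : 'I_n) :
  (place i s)^-1 j = moved_pos (s^-1 i) i (s^-1 j) :> nat.
Proof. by rewrite /place invgK permM permE. Qed.

Definition at_home n (s : 'S_n) (i : 'I_n) : bool := s i == i.

Definition placement n : rel 'S_n :=
  [rel s t | [exists i : 'I_n, ~~ at_home s i && (t == place i s)]].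

Definition reachable_in n (s : 'S_n) (m : nat) : Prop :=
  exists p : seq 'S_n,
    [/\ path (@placement n) s p, last s p = 1 & size p = m].

Definition requires_steps n (s : 'S_n) (m : nat) : Prop :=
  reachable_in s m /\ (forall k : nat, reachable_in s k -> m <= k).

Definition reverse_perm n : 'S_n := perm (@rev_ord_inj n).

(* Main.v *)
Require Import Defs.
From mathcomp Require Import all_boot all_order all_fingroup.
From mathcomp Require Import zify.

(** Numbers that are never placed keep their relative order, and the reverse
    permutation has every pair out of order; so all numbers but one must be
    placed, which costs [n - 1] steps ([unplaced_sorted],
    [reverse_lower_bound]).

    Conversely, suppose that the numbers outside a window [a, b) are at home.
    Placing [a] or [b - 1] shrinks the window by one, and a window of size one
    is sorted, so [b - a - 1] steps suffice ([sort_window]).  If the window is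
    not reversed, one step can be saved ([sort_nonreversed_window]), by
    induction on its size.  When [a] is at home, the window shrinks for free.
    Otherwise place [a]; the induction goes on unless this leaves the smaller
    window reversed.  In that case the window reads
    [b-1, ..., a, ...] with [a] strictly inside, and placing [b - 1] instead
    leaves a smaller window in which [a] is not last, hence one that is not
    reversed. *)

Set Implicit Arguments.
Unset Strict Implicit.
Unset Printing Implicit Defensive.

Section Placement.

Local Open Scope group_scope.

Variable n : nat.
Implicit Types (s : 'S_n) (i j : 'I_n) (a b m : nat).

Definition pos s j : nat := s^-1 j.

Lemma pos_inj s : injective (pos s).
Proof. by move=> i j /val_inj/perm_inj. Qed.

Lemma pos1 j : pos 1 j = j.
Proof. by rewrite /pos invg1 perm1. Qed.

Lemma eq_pos s t : pos s =1 pos t -> s = t.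
Proof.
by move=> eq_st; apply: invg_inj; apply/permP => j; apply/val_inj/eq_st.
Qed.

Lemma pos_place s i j : pos (place i s) j = moved_pos (pos s i) i (pos s j).
Proof. exact: place_posE. Qed.

Lemma at_home_pos s i : at_home s i = (pos s i == i).
Proof. by rewrite /at_home (canF_eq (permK s)) eq_sym. Qed.

Lemma place_at_home s i : at_home s i -> place i s = s.
Proof.
rewrite at_home_pos => /eqP home_i; apply: eq_pos => j.
rewrite pos_place home_i /moved_pos.
by repeat case: ifP => /= ?; lia.
Qed.

(** A placement moves the other numbers without exchanging any two of them, so
    the numbers outside the set [A] of those placed along the path are already
    in the order in which they end up. *)
Lemma unplaced_sorted s (p : seq 'S_n) :
    path (@placement n) s p -> last s p = 1 ->
  exists2 A : {set 'I_n}, #|A| <= size p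
    & forall i j, i \notin A -> j \notin A -> i < j -> pos s i < pos s j.
Proof.
elim: p s => [|t p IHp] s /=.
  by move=> _ ->; exists set0 => [|i j _ _]; rewrite ?cards0 // !pos1.
case/andP=> /existsP[k /andP[_ /eqP->]] path_p last_p.
have [A leAp ordA] := IHp _ path_p last_p.
exists (k |: A) => [|i j]; first by rewrite cardsU1; case: (k \notin A); lia.
rewrite !in_setU1 !negb_or => /andP[neq_ik Ai] /andP[neq_jk Aj] lt_ij.
have := ordA i j Ai Aj lt_ij; rewrite !pos_place /moved_pos.
have : pos s i != pos s k by rewrite (inj_eq (@pos_inj s)).
have : pos s j != pos s k by rewrite (inj_eq (@pos_inj s)).
by repeat case: ifP => /= ?; lia.
Qed.

Lemma pos_reverse_perm j : pos (reverse_perm n) j = n - j.+1.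
Proof.
rewrite /pos; suff -> : (reverse_perm n)^-1 j = rev_ord j by [].
apply: (@perm_inj _ (reverse_perm n)).
by rewrite permKV permE rev_ordK.
Qed.

Lemma reverse_lower_bound m : reachable_in (reverse_perm n) m -> n.-1 <= m.
Proof.
case=> p [path_p last_p <-]; have [A leAp ordA] := unplaced_sorted path_p last_p.
have : #|~: A| <= 1.
  apply/card_le1_eqP => i j; rewrite !inE => Ai Aj; apply: val_inj.
  have := ordA i j Ai Aj; have := ordA j i Aj Ai; rewrite !pos_reverse_perm /=.
  by have := ltn_ord i; have := ltn_ord j; lia.
by have := cardsC A; rewrite card_ord; lia.
Qed.

(** Placing a number that is at home changes nothing but is not a legal step;
    counting steps up to an upper bound makes it harmless
    ([reachable_within_place]). *)
Definition reachable_within s m := exists2 k, k <= m & reachable_in s k.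

Definition home_outside a b s :=
  forall j, ~~ (a <= j < b) -> pos s j = j.

(** The mirror image [a + b - 1 - j] of [j] in the window [a, b) is written as a
    sum because subtraction is truncated. *)
Definition reversed_on a b s :=
  [forall j : 'I_n, (a <= j < b) ==> (pos s j + j.+1 == a + b)].

Lemma reachable_within_place s i m :
  reachable_within (place i s) m -> reachable_within s m.+1.
Proof.
case=> k le_km [p [path_p last_p size_p]].
have [home_i|away_i] := boolP (at_home s i).
  exists k; first exact: leqW.
  by exists p; rewrite place_at_home // in path_p last_p.
exists k.+1 => //; exists (place i s :: p); split=> //=; last by rewrite size_p.
by rewrite path_p andbT; apply/existsP; exists i; rewrite away_i eqxx.
Qed.

Lemma window_stable a b s j :
  home_outside a b s -> a <= j < b -> a <= pos s j < b.
Proof.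
move=> home_s win_j; case: (boolP (a <= pos s j < b)) => // out.
suff eq_j : s^-1 j = j by rewrite /pos eq_j win_j in out.
exact/(@pos_inj s)/(home_s (s^-1 j)).
Qed.

Lemma place_home_outside a b s i j :
    home_outside a b s -> a <= i < b -> ~~ (a <= j < b) || (j == i :> nat) ->
  pos (place i s) j = j.
Proof.
move=> home_s win_i; have := window_stable home_s win_i.
rewrite pos_place /moved_pos; have [->|neq_ji] := eqVneq j i.
  by rewrite !eqxx.
rewrite -(inj_eq val_inj) /= in neq_ji; rewrite (negPf neq_ji) orbF => win out_j.
have -> : pos s j = j by exact: home_s.
by repeat case: ifP => /= ?; lia.
Qed.

(** Placing the first number of the window shifts only numbers inside it, so
    that number joins those at home; once one number is left, it is at home
    too. *)
Lemma sort_window a b s :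
  b <= n -> home_outside a b s -> reachable_within s (b - a).-1.
Proof.
move=> le_bn; have [d] := ubnP (b - a); elim: d a s => // d IHd a s lt_d home_s.
have [small|large] := leqP (b - a) 1.
  have -> : s = 1.
    apply: eq_pos => j; rewrite pos1.
    have [win_j|/home_s//] := boolP (a <= j < b).
    by have := window_stable home_s win_j; lia.
  by exists 0 => //; exists [::].
have lt_an : a < n by lia.
have -> : (b - a).-1 = (b - a.+1).-1.+1 by lia.
apply: (@reachable_within_place _ (Ordinal lt_an)); apply: IHd; first by lia.
by move=> j out_j; apply: (place_home_outside home_s) => /=; lia.
Qed.

(** The second conjunct makes the truncated [(b - a).-2] a genuine saving: a
    window of size at most one is always reversed. *)
Lemma sort_nonreversed_window a b s :
    b <= n -> home_outside a b s -> ~~ reversed_on a b s ->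
  reachable_within s (b - a).-2 /\ 2 <= b - a.
Proof.
have [d] := ubnP (b - a); elim: d a b s => // d IHd a b s lt_d le_bn home_s rev_s.
have gt1_ab : 2 <= b - a.
  rewrite leqNgt; apply: contra rev_s => small; apply/forallP => j.
  apply/implyP => win_j; have := window_stable home_s win_j.
  by move=> ?; apply/eqP; lia.
split=> //; have lt_an : a < n by lia.
pose i0 := Ordinal lt_an.
have home_s0 : home_outside a.+1 b (place i0 s).
  by move=> j out_j; apply: (place_home_outside home_s) => /=; lia.
have [home_i0|away_i0] := boolP (at_home s i0).
  rewrite place_at_home // in home_s0.
  have -> : (b - a).-2 = (b - a.+1).-1 by lia.
  exact: sort_window.
have [rev_s0|nrev_s0] := boolP (reversed_on a.+1 b (place i0 s)); last first.
  have lt_d' : b - a.+1 < d by lia.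
  have [sorted_s0 gt1] := IHd _ _ _ lt_d' le_bn home_s0 nrev_s0.
  have -> : (b - a).-2 = (b - a.+1).-2.+1 by lia.
  exact: reachable_within_place sorted_s0.
have win_i0 : a <= i0 < b by rewrite /=; lia.
have pos_i0 := window_stable home_s win_i0.
have neq_a : pos s i0 <> a.
  by move=> eq_a; rewrite at_home_pos eq_a eqxx in away_i0.
have rev0 j : a < j < b -> moved_pos (pos s i0) a (pos s j) + j.+1 = a.+1 + b.
  move=> win_j; move/forallP/(_ j): rev_s0; rewrite win_j => /eqP.
  by rewrite pos_place.
have pos_neq j : j != i0 -> pos s j <> pos s i0.
  by move=> neq_j /pos_inj eq_j; rewrite eq_j eqxx in neq_j.
(* Since placing [a] leaves a reversed window, [s] itself would be reversed on
   the whole window if [a] were in its last position. *)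
have pos_i0_inner : (pos s i0).+1 < b.
  rewrite ltnNge; apply: contra rev_s => last_i0; apply/forallP => j.
  apply/implyP => win_j; have := window_stable home_s win_j.
  have [-> _|neq_j pos_j] := eqVneq j i0; first by apply/eqP => /=; lia.
  have := pos_neq j neq_j; rewrite -(inj_eq val_inj) /= in neq_j.
  have win_j' : a < j < b by lia.
  have := rev0 j win_j'; rewrite /moved_pos.
  by repeat case: ifP => /= ?; lia.
case: b => [|c] in lt_d le_bn home_s rev_s gt1_ab home_s0 rev_s0 win_i0 pos_i0
  rev0 pos_i0_inner *; first by lia.
(* The first number of the reversed smaller window is [b - 1], so it comes first
   in [s] as well. *)
pose i1 := Ordinal le_bn.
have neq_i1 : i1 != i0 by rewrite -(inj_eq val_inj) /=; lia.
have pos_i1 : pos s i1 = a.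
  have win_i1 : a < i1 < c.+1 by rewrite /=; lia.
  have win_i1' : a <= i1 < c.+1 by rewrite /=; lia.
  have := window_stable home_s win_i1'; have := pos_neq _ neq_i1.
  have := rev0 _ win_i1; rewrite /moved_pos /=.
  by repeat case: ifP => /= ?; lia.
have home_s1 : home_outside a c (place i1 s).
  by move=> j out_j; apply: (place_home_outside home_s) => /=; lia.
(* Removing [b - 1] from the front shifts [a] left by one, to a position that
   is still not the last one of the smaller window. *)
have nrev_s1 : ~~ reversed_on a c (place i1 s).
  apply/forallP => /(_ i0); rewrite pos_place pos_i1 /moved_pos /=.
  by repeat case: ifP => /= ?; lia.
have lt_d' : c - a < d by lia.
have [sorted_s1 gt1] := IHd _ _ _ lt_d' (ltnW le_bn) home_s1 nrev_s1.
have -> : (c.+1 - a).-2 = (c - a).-2.+1 by lia.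
exact: reachable_within_place sorted_s1.
Qed.

End Placement.

Theorem theorem4p5 (n : nat) (n_ge1 : 1 <= n) (s : 'S_n) :
  requires_steps s n.-1 <-> s = reverse_perm n.
Proof.
have home_s : home_outside 0 n s by move=> j; rewrite ltn_ord.
split=> [[_ min_s]|eq_s].
  have [rev_s|nrev_s] := boolP (reversed_on 0 n s).
    apply: eq_pos => j; rewrite pos_reverse_perm.
    by move/forallP/(_ j): rev_s; rewrite ltn_ord => /eqP; lia.
  have [[k le_k /min_s]] := sort_nonreversed_window (leqnn n) home_s nrev_s.
  by lia.
have [k le_k reach_k] := sort_window (leqnn n) home_s.
rewrite eq_s in reach_k *; have ge_k := reverse_lower_bound reach_k.
have <- : k = n.-1 by lia.
split=> // m /reverse_lower_bound; lia.
Qed.
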